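(* Let $K_{m,n}$ be a complete bipartite graph, and let $a$ and $b$ be two (distinct) vertices in a partite set having $m$ vertices (the other partite set having $n$ vertices). Then: (1) the complementary prism $K_{m,n}\overline{K_{m,n}}$ exhibits perfect state transfer between $\frac{1}{\sqrt{2}}(\mathbf{e}_a-\mathbf{e}_b)$ and $\frac{1}{\sqrt{2}}(\mathbf{e}_{a'}-\mathbf{e}_{b'})$ with respect to the Laplacian matrix if and only if $m=n$; (2) it exhibits perfect state transfer between these two states with respect to the signless Laplacian matrix if and only if $m-n=2$; (3) with respect to the adjacency matrix, there is no perfect state transfer between $\frac{1}{\sqrt{2}}(\mathbf{e}_a-\mathbf{e}_b)$ and $\frac{1}{\sqrt{2}}(\mathbf{e}_{a'}-\mathbf{e}_{b'})$.
   Context: The complementary prism $G\overline{G}$ of a graph $G$ is obtained from the disjoint union of $G$ and its complement $\overline{G}$ (vertices relabelled $a'$ for $a\in V(G)$) by adding an edge between each vertex $a$ of $G$ and its copy $a'$ in $\overline{G}$. With $A$ the adjacency matrix and $D$ the diagonal degree matrix, the Laplacian is $L=D-A$ and the signless Laplacian is $Q=D+A$. For a real symmetric matrix $M$ associated with a graph, $U_M(t)=\exp(itM)$. There is perfect state transfer between two linearly independent real unit vectors $\mathbf{u},\mathbf{v}$ with respect to $M$ if there exist $\tau>0$ and $\gamma\in\mathbb{C}$ with $|\gamma|=1$ such that $U_M(\tau)\mathbf{u}=\gamma\mathbf{v}$. $\mathbf{e}_x$ is the characteristic vector of the vertex $x$ of $K_{m,n}\overline{K_{m,n}}$. *)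

(* Defs.v *)
From HB Require Import structures.
From mathcomp Require Import all_boot all_order all_algebra.
From mathcomp Require Import complex.
From mathcomp Require Import all_classical all_reals all_analysis.

Set Implicit Arguments.
Unset Strict Implicit.
Unset Printing Implicit Defensive.

Import Order.TTheory GRing.Theory Num.Theory.
Import numFieldNormedType.Exports.

Local Open Scope classical_set_scope.
Local Open Scope ring_scope.
Local Open Scope complex_scope.

Record sgraph (T : finType) := SGraph {
  adj :> rel T;
  adj_sym : symmetric adj;
  adj_irr : irreflexive adj
}.

Section GraphConstructions.
Variable T : finType.
Variable G : sgraph T.

Definition compl_adj : rel T := fun x y => (x != y) && ~~ G x y.

Lemma compl_adj_sym : symmetric compl_adj.
Proof. by move=> x y; rewrite /compl_adj eq_sym adj_sym. Qed.

Lemma compl_adj_irr : irreflexive compl_adj.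
Proof. by move=> x; rewrite /compl_adj eqxx. Qed.

Definition complement_graph : sgraph T := SGraph compl_adj_sym compl_adj_irr.

(* [inl x] is the vertex x of G and [inr x] is its copy x' in the complement. *)
Definition prism_adj : rel (T + T)%type := fun u v =>
  match u, v with
  | inl x, inl y => G x y
  | inr x, inr y => complement_graph x y
  | inl x, inr y | inr x, inl y => x == y
  end.

Lemma prism_adj_sym : symmetric prism_adj.
Proof.
case=> x [] y /=; [exact: adj_sym | exact: eq_sym | exact: eq_sym |].
exact: compl_adj_sym.
Qed.

Lemma prism_adj_irr : irreflexive prism_adj.
Proof. by case=> x /=; rewrite ?compl_adj_irr ?adj_irr. Qed.

Definition complementary_prism : sgraph (T + T)%type :=
  SGraph prism_adj_sym prism_adj_irr.

End GraphConstructions.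

Section CompleteBipartite.
Variables m n : nat.

Definition Kmn_adj : rel ('I_m + 'I_n)%type := fun u v =>
  match u, v with
  | inl _, inr _ | inr _, inl _ => true
  | _, _ => false
  end.

Lemma Kmn_adj_sym : symmetric Kmn_adj.
Proof. by case=> x []. Qed.

Lemma Kmn_adj_irr : irreflexive Kmn_adj.
Proof. by case. Qed.

Definition complete_bipartite : sgraph ('I_m + 'I_n)%type :=
  SGraph Kmn_adj_sym Kmn_adj_irr.

End CompleteBipartite.

(* Rows and columns are indexed by the vertices, through their enumeration. *)
Section GraphMatrices.
Variables (R : realType) (T : finType) (G : sgraph T).

Definition degree (x : T) : nat := #|[set y | G x y]|.

Definition adjacency_mx : 'M[R]_#|T| :=
  \matrix_(i, j) (G (enum_val i) (enum_val j))%:R.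

Definition degree_mx : 'M[R]_#|T| :=
  diag_mx (\row_i (degree (enum_val i))%:R).

Definition laplacian_mx : 'M[R]_#|T| := degree_mx - adjacency_mx.

Definition signless_laplacian_mx : 'M[R]_#|T| := degree_mx + adjacency_mx.

End GraphMatrices.

Definition char_vec (R : realType) (T : finType) (x : T) : 'cV[R]_#|T| :=
  delta_mx (enum_rank x) 0.

Definition pair_state (R : realType) (T : finType) (x y : T) : 'cV[R]_#|T| :=
  (Num.sqrt 2)^-1 *: (char_vec R x - char_vec R y).

Definition expmx (K : numFieldType) (N : nat) (A : 'M[K]_N) : 'M[K]_N :=
  limn (series (fun k : nat => (k`!%:R)^-1 *: A ^+ k)).

Definition complexify (R : realType) (p q : nat) (A : 'M[R]_(p, q)) :
  'M[R[i]]_(p, q) := map_mx (real_complex R) A.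

Definition transition_mx (R : realType) (N : nat) (M : 'M[R]_N) (t : R) :
  'M[R[i]]_N := expmx (('i%C * t%:C) *: complexify M).

(* Unit vectors are meant for the Euclidean norm; the norm that the library
   puts on matrices is the maximum norm. *)
Definition perfect_state_transfer (R : realType) (N : nat) (M : 'M[R]_N)
    (u v : 'cV[R]_N) : Prop :=
  [/\ u^T *m u = 1%:M, v^T *m v = 1%:M, free [:: u; v] &
      exists (tau : R) (gamma : R[i]),
        [/\ 0 < tau, `|gamma| = 1 &
            transition_mx M tau *m complexify u = gamma *: complexify v]].

Lemma char_vec_dot (R : realType) (T : finType) (x y : T) :
  (char_vec R x)^T *m char_vec R y = (x == y)%:R%:M.
Proof.
rewrite /char_vec trmx_delta mul_delta_mx_cond (inj_eq enum_rank_inj).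
by apply/matrixP=> i j; rewrite !mxE !ord1 mulmxnE mxE /= mulr1n.
Qed.

Lemma pair_state_dot (R : realType) (T : finType) (x y z w : T) :
  (pair_state R x y)^T *m pair_state R z w =
  (2^-1 * ((x == z)%:R - (x == w)%:R - (y == z)%:R + (y == w)%:R))%:M.
Proof.
have dotB (p q r s : 'cV[R]_#|T|) (c : R) :
    (c *: (p - q))^T *m (c *: (r - s)) =
    (c * c) *: (p^T *m r - p^T *m s - q^T *m r + q^T *m s).
  rewrite -scalemxAr [(_ *: _)^T]linearZ /= -scalemxAl scalerA.
  by rewrite [(p - q)^T]linearB /= mulmxBl !mulmxBr opprB addrCA addrC.
rewrite /pair_state dotB !char_vec_dot -invfM -expr2 sqr_sqrtr //.
by rewrite -!raddfB -raddfD scale_scalar_mx.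
Qed.

(* Pair states on disjoint pairs satisfy the standing requirements of
   [perfect_state_transfer]. *)
Lemma pair_state_unit (R : realType) (T : finType) (x y : T) :
  x != y -> (pair_state R x y)^T *m pair_state R x y = 1%:M.
Proof.
move=> xy; rewrite pair_state_dot !eqxx [y == x]eq_sym (negbTE xy) !subr0.
by rewrite -(natrD _ 1 1) mulVf.
Qed.

Lemma pair_state_free (R : realType) (T : finType) (x y z w : T) :
  x != y -> z != w -> [/\ x != z, x != w, y != z & y != w] ->
  free [:: pair_state R x y; pair_state R z w].
Proof.
move=> xy zw [xz xw yz yw]; rewrite free_cons seq1_free span_seq1.
set u := pair_state R x y; set v := pair_state R z w.
have uu : u^T *m u = 1%:M by apply: pair_state_unit.
have vv : v^T *m v = 1%:M by apply: pair_state_unit.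
have uv : u^T *m v = 0.
  rewrite pair_state_dot (negbTE xz) (negbTE xw) (negbTE yz) (negbTE yw).
  by rewrite !subr0 addr0 mulr0 raddf0.
have M1 : (1%:M : 'M[R]_1) != 0 by rewrite oner_neq0.
apply/andP; split; last first.
  by apply: contra_neq M1 => v0; rewrite -vv v0 mulmx0.
apply/negP=> /vlineP [k uk].
by move/eqP: M1; apply; rewrite -uu {2}uk -scalemxAr uv scaler0.
Qed.

(* Main.v *)
Require Import Defs.
From mathcomp Require Import all_boot all_order all_algebra.
From mathcomp Require Import complex ring zify.
From mathcomp Require Import all_classical all_reals all_analysis.

Set Implicit Arguments.
Unset Strict Implicit.
Unset Printing Implicit Defensive.

Import Order.TTheory GRing.Theory Num.Theory.
Import numFieldNormedType.Exports.

Local Open Scope classical_set_scope.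
Local Open Scope ring_scope.
Local Open Scope complex_scope.

(** For each of the three matrices M, the states u = (e_a - e_b) / sqrt 2 and
    v = (e_a' - e_b') / sqrt 2 span an M-invariant plane.  Indeed a and b are
    twins in K_(m,n), and a', b' are twins in the complement up to the edge
    joining them, so the contributions of all other vertices cancel and
    A u = v, A v = u - v.  Since a and b have degree n + 1, and a' and b' have
    degree m, M acts on the orthonormal pair (u, v) by a symmetric 2 x 2 matrix
    with diagonal (p, q) and off-diagonal entry c:
    - Laplacian: p = n + 1, q = m + 1, c = -1;
    - signless Laplacian: p = n + 1, q = m - 1, c = 1;
    - adjacency: p = 0, q = -1, c = 1.
    The theorem follows from [perfect_state_transfer_plane]: when c <> 0, there
    is perfect state transfer from u to v exactly when p = q.

    That criterion only uses what exp(itM) does to real eigenvectors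
    ([transition_mx_eigenvec]) and the symmetry of exp(itM)
    ([transition_mx_sym]).  The plane contains an eigenvector w = u + x v,
    where c x^2 + (p - q) x - c = 0.  If exp(itM) u = g v, pairing with w gives
    e^(itl) = g x for the eigenvalue l of w, so |x| = 1, and the quadratic
    equation then forces p = q.  Conversely, if p = q then u + v and u - v are
    eigenvectors for p + c and p - c; at time pi / (2 |c|) their phases are
    opposite, and so u is sent to a multiple of v.

    The exponential is the limit of a series of complex matrices, so these two
    facts rest on the convergence of that series ([cvg_transition_mx]), which
    is obtained entry by entry from the real exponential series. *)

(** * Complex series and the unit circle *)

Section ComplexSequences.
Variable R : realType.
(* The topology on complex numbers comes from their structure of numFieldType,
   which the bare type does not display. *)
Local Notation C := (R[i] : numFieldType).
Implicit Types (u v r : R^nat) (a b x y : R) (k : nat).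

Lemma normc_real x : `|x%:C| = `|x|%:C :> R[i].
Proof. by rewrite normc_def /= expr0n addr0 sqrtr_sqr. Qed.

Lemma cvg_real_complex u a :
  u @ \oo --> a -> (fun k => (u k)%:C : C) @ \oo --> (a%:C : C).
Proof.
move=> ua; apply/cvgrPdist_lt => e e0.
have eE : (complex.Re e)%:C = e by apply: RRe_real; apply: gtr0_real.
have Re0 : 0 < complex.Re e by rewrite -ltcR eE.
move/cvgrPdist_lt: ua => /(_ _ Re0); apply: filterS => k.
by rewrite -eE -rmorphB normc_real ltcR.
Qed.

Lemma cvg_series_complex u v a b :
    series u @ \oo --> a -> series v @ \oo --> b ->
  series (fun k => (u k)%:C + 'i%C * (v k)%:C : C) @ \oo
    --> (a%:C + 'i%C * b%:C : C).
Proof.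
move=> /cvg_real_complex ua /cvg_real_complex vb.
rewrite (_ : series _ = (fun n => (series u n)%:C + 'i%C * (series v n)%:C)).
  by apply: cvgD ua _; apply: cvgMl_tmp vb.
apply/funext=> n; rewrite /series /= big_split /= !rmorph_sum.
by rewrite mulr_sumr.
Qed.

(** The coefficients are those of the cosine and sine series, so that the
    exponential of an imaginary number splits into these two series. *)
Lemma exprIE k : 'i%C ^+ k =
  ((~~ odd k)%:R * (-1) ^+ k./2)%:C +
  'i%C * ((odd k)%:R * (-1) ^+ k.-1./2)%:C :> R[i].
Proof.
rewrite -{1}[k]odd_double_half exprD -mul2n exprM sqr_i.
case ok: (odd k); last by rewrite !mul0r mulr0 addr0 !mul1r rmorphXn rmorphN1.
rewrite mul0r add0r expr1 !mul1r rmorphXn rmorphN1; congr (_ * _ ^+ _).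
by case: k ok => //= k /negbTE ok; rewrite uphalf_half ok.
Qed.

Definition cis x : C := (cos x)%:C + 'i%C * (sin x)%:C.

Lemma cvg_series_cis x :
  series (fun k => (k`!%:R)^-1 * ('i%C * x%:C) ^+ k : C) @ \oo --> cis x.
Proof.
have -> : (fun k => (k`!%:R)^-1 * ('i%C * x%:C) ^+ k) =
    (fun k => (cos_coeff x k)%:C + 'i%C * (sin_coeff x k)%:C) :> C^nat.
  apply/funext=> k; rewrite exprMn exprIE /cos_coeff /sin_coeff /=.
  rewrite !rmorphM !rmorphXn fmorphV !rmorphN1 !rmorph_nat.
  by ring.
apply: cvg_series_complex; rewrite unlock;
  [exact: is_cvg_series_cos_coeff | exact: is_cvg_series_sin_coeff].
Qed.

Lemma cisD x y : cis (x + y) = cis x * cis y.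
Proof.
apply/eqP; rewrite /cis cosD sinD eq_complex /=; apply/andP; split; apply/eqP;
  ring.
Qed.

Lemma norm_cis x : `|cis x| = 1.
Proof.
rewrite normc_def /cis /= !(mul0r, mul1r, add0r, addr0, subr0, mulr0).
by rewrite cos2Dsin2 sqrtr1.
Qed.

(** The real and imaginary parts converge absolutely, since their terms are
    dominated by those of the series of e^B. *)
Lemma is_cvg_series_geometric_bound r B :
    (forall k, `|r k| <= B ^+ k) ->
  cvgn (series (fun k => (k`!%:R)^-1 * ('i%C ^+ k * (r k)%:C) : C)).
Proof.
move=> rB.
have B0 : 0 <= B by have := rB 1%N; rewrite expr1; exact: le_trans.
have cvg_part (s : R^nat) : (forall k, `|s k| <= 1) ->
    cvgn (series (fun k => (k`!%:R)^-1 * (s k * r k))).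
  move=> s1; apply: normed_cvg.
  apply: series_le_cvg (is_cvg_series_exp_coeff B) => k /=.
  - exact: normr_ge0.
  - exact: exp_coeff_ge0.
  rewrite normrM mulrC (@ger0_norm _ _^-1) ?invr_ge0 //.
  rewrite ler_wpM2r ?invr_ge0 // normrM.
  by rewrite -[leRHS]mul1r ler_pM.
pose c k : R := (~~ odd k)%:R * (-1) ^+ k./2.
pose s k : R := (odd k)%:R * (-1) ^+ k.-1./2.
have c1 k : `|c k| <= 1.
  rewrite normrM normrX normrN1 expr1n mulr1.
  by case: odd; rewrite ?normr0 ?normr1.
have s1 k : `|s k| <= 1.
  rewrite normrM normrX normrN1 expr1n mulr1.
  by case: odd; rewrite ?normr0 ?normr1.
have -> : (fun k => (k`!%:R)^-1 * ('i%C ^+ k * (r k)%:C)) =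
    (fun k => ((k`!%:R)^-1 * (c k * r k))%:C +
              'i%C * ((k`!%:R)^-1 * (s k * r k))%:C) :> C^nat.
  apply/funext=> k; rewrite exprIE -/(c k) -/(s k) !rmorphM fmorphV !rmorph_nat.
  by ring.
exact: cvgP (cvg_series_complex (cvg_part _ c1) (cvg_part _ s1)).
Qed.

End ComplexSequences.

(** * Powers and exponentials of matrices *)

(** Matrices of size 0 form a trivial ring, so that for an arbitrary size these
    laws are not instances of those of algebras. *)
Section MatrixPowers.
Variable N : nat.

Lemma mxXS (K : pzRingType) (A : 'M[K]_N) k : A ^+ k.+1 = A *m A ^+ k.
Proof. exact: exprS. Qed.

Lemma mxXSr (K : pzRingType) (A : 'M[K]_N) k : A ^+ k.+1 = A ^+ k *m A.
Proof. exact: exprSr. Qed.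

Lemma scalemxX (K : comPzRingType) (x : K) (A : 'M[K]_N) k :
  (x *: A) ^+ k = x ^+ k *: A ^+ k.
Proof.
elim: k => [|k IH]; first by rewrite !expr0 scale1r.
by rewrite !mxXS IH -scalemxAr -scalemxAl scalerA exprSr.
Qed.

Lemma map_mxX (K L : pzRingType) (f : {rmorphism K -> L}) (A : 'M[K]_N) k :
  map_mx f (A ^+ k) = map_mx f A ^+ k.
Proof.
by elim: k => [|k IH]; [rewrite !expr0 map_mx1 | rewrite !mxXS map_mxM IH].
Qed.

Lemma trmxX (K : comPzRingType) (A : 'M[K]_N) k : (A ^+ k)^T = A^T ^+ k.
Proof.
elim: k => [|k IH]; first by rewrite !expr0 trmx1.
by rewrite mxXSr mxXS trmx_mul IH.
Qed.

End MatrixPowers.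

Section MatrixExponential.
Variables (R : realType) (N : nat).
Local Notation C := (R[i] : numFieldType).
Implicit Types (M : 'M[R]_N) (t l : R).

(** B is the sum of the absolute values of all entries, which dominates every
    row sum: each multiplication by M multiplies the bound by at most B. *)
Lemma exprmx_entry_bound M : exists B : R,
  forall k i j, `|(M ^+ k) i j| <= B ^+ k.
Proof.
exists (\sum_i \sum_j `|M i j|); elim=> [|k IH] i j.
  by rewrite expr0 mxE expr0; case: (i == j); rewrite ?normr1 ?normr0.
have row_le : \sum_h `|M i h| <= \sum_i \sum_j `|M i j|.
  by rewrite [leRHS](bigD1 i) //= lerDl; do 2?apply: sumr_ge0 => ? _.
rewrite mxXS mxE (le_trans (ler_norm_sum _ _ _)) //.
rewrite exprS (le_trans _ (ler_wpM2r _ row_le)) ?exprn_ge0 //; last first.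
  by do 2?apply: sumr_ge0 => ? _.
by rewrite mulr_suml ler_sum // => h _; rewrite normrM ler_wpM2l.
Qed.

(** A matrix is the finite sum of its entries times elementary matrices, so this
    follows from the continuity of sums and scalings. *)
Lemma cvg_mx_entries p q (A : ('M[C]_(p, q))^nat) (L : 'M[C]_(p, q)) :
  (forall i j, (fun n => A n i j) @ \oo --> L i j) -> A @ \oo --> L.
Proof.
move=> AL; rewrite (matrix_sum_delta L).
have -> : A = (fun n => \sum_i \sum_j A n i j *: delta_mx i j).
  by apply/funext=> n; rewrite -matrix_sum_delta.
apply: cvg_big => [|i _]; first exact: add_continuous.
apply: cvg_big => [|j _]; first exact: add_continuous.
exact: cvgZr_tmp (AL i j).
Qed.

(** This is what gives a meaning to [expmx], whose value is a limit only when
    the series converges.  Writing (it M)^k = i^k (tM)^k separates the powers of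
    i from the entries of a real matrix. *)
Lemma cvg_transition_mx M t :
  series (fun k => (k`!%:R)^-1 *: (('i%C * t%:C) *: complexify M) ^+ k
           : 'M[C]_N) @ \oo --> (transition_mx M t : 'M[C]_N).
Proof.
have [B MB] := exprmx_entry_bound (t *: M).
(* A convergent sequence converges to its limit, by definition of [cvgn]. *)
suff : cvgn (series (fun k => (k`!%:R)^-1 *:
    (('i%C * t%:C) *: complexify M) ^+ k : 'M[C]_N)) by [].
have entry k i j : ((k`!%:R)^-1 *: (('i%C * t%:C) *: complexify M) ^+ k) i j =
    (k`!%:R)^-1 * ('i%C ^+ k * (((t *: M) ^+ k) i j)%:C).
  rewrite mxE; congr (_ * _).
  rewrite -scalerA -map_mxZ scalemxX mxE; congr (_ * _).
  by rewrite -map_mxX mxE.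
have ec i j : exists l : C, series (fun k => (k`!%:R)^-1 *
    ('i%C ^+ k * (((t *: M) ^+ k) i j)%:C) : C) @ \oo --> l.
  apply/cvg_ex; apply: (@is_cvg_series_geometric_bound _ _ B) => k.
  exact: MB.
pose L : 'M[C]_N := \matrix_(i, j) sval (cid (ec i j)).
apply/cvg_ex; exists L; apply: cvg_mx_entries => i j.
under eq_cvg => n do
  rewrite /series /= summxE (eq_bigr _ (fun k _ => entry k i j)).
by rewrite mxE; exact: svalP (cid (ec i j)).
Qed.

Lemma cvg_mx_entry p q (A : ('M[C]_(p, q))^nat) (L : 'M[C]_(p, q)) i j :
  A @ \oo --> L -> (fun n => A n i j) @ \oo --> L i j.
Proof.
have := @continuous_cvg _ _ _ \oo _ A (fun B : 'M[C]_(p, q) => B i j) L.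
by apply; exact: coord_continuous.
Qed.

Lemma transition_mx_sym M t :
  M^T = M -> (transition_mx M t)^T = transition_mx M t.
Proof.
move=> Msym.
apply: (cvg_unique (@norm_hausdorff _ 'M[C]_N) _ (@cvg_transition_mx M t)).
apply: cvg_mx_entries => i j; rewrite mxE.
pose S := series (fun k => (k`!%:R)^-1 *: (('i%C * t%:C) *: complexify M) ^+ k
                    : 'M[C]_N).
have S_sym n : S n j i = S n i j.
  rewrite /S /series /= !summxE; apply: eq_bigr => k _; rewrite !mxE.
  by rewrite -[in RHS]Msym /complexify -map_trmx -linearZ /= -trmxX mxE.
rewrite -[X in X @ _ --> _]/(fun n => S n i j) -(eq_cvg _ _ S_sym).
exact: cvg_mx_entry (@cvg_transition_mx M t).
Qed.

(** On an eigenvector the partial sums of the matrix series are those of the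
    scalar series of e^(itl), and limits are unique. *)
Lemma transition_mx_eigenvec M t l (w : 'cV[R]_N) :
    M *m w = l *: w ->
  transition_mx M t *m complexify w = cis (t * l) *: complexify w.
Proof.
move=> Mw; pose A := ('i%C * t%:C) *: complexify M.
have Aw k : A ^+ k *m complexify w = ('i%C * (t * l)%:C) ^+ k *: complexify w.
  elim: k => [|k IH]; first by rewrite !expr0 mul1mx scale1r.
  rewrite mxXSr -mulmxA -scalemxAl -map_mxM Mw map_mxZ scalerA -scalemxAr IH.
  by rewrite scalerA rmorphM mulrA -exprS.
pose S := series (fun k => (k`!%:R)^-1 *: A ^+ k : 'M[C]_N).
apply/matrixP=> i j.
have lim_mx : (fun n => (S n *m complexify w) i j) @ \oo -->
    ((transition_mx M t *m complexify w) i j : C).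
  under eq_cvg => n do rewrite mxE.
  rewrite mxE; apply: cvg_big => [|h _]; first exact: add_continuous.
  have S_entry := cvg_mx_entry (i := i) (j := h) (@cvg_transition_mx M t).
  have := @cvgMr_tmp C nat \oo _ (fun n => S n i h) _ (complexify w h j)
    S_entry.
  by apply; exact: eventually_filter.
have S_eigen n : (S n *m complexify w) i j =
    series (fun k => (k`!%:R)^-1 * ('i%C * (t * l)%:C) ^+ k : C) n *
    complexify w i j.
  rewrite /S /series /= mulmx_suml mulr_suml summxE; apply: eq_bigr => k _.
  by rewrite -scalemxAl Aw scalerA [LHS]mxE.
have lim_cis : (fun n => (S n *m complexify w) i j) @ \oo -->
    (cis (t * l) * complexify w i j : C).
  by rewrite (eq_cvg _ _ S_eigen); apply: cvgMr_tmp; exact: cvg_series_cis.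
by rewrite [RHS]mxE; apply: (cvg_unique (@norm_hausdorff _ C) lim_mx lim_cis).
Qed.

End MatrixExponential.
(** * Transfer inside an invariant plane *)

Section InvariantPlane.
Variables (R : realType) (N : nat) (M : 'M[R]_N) (u v : 'cV[R]_N) (p q c : R).
Hypotheses (M_sym : M^T = M) (uu : u^T *m u = 1%:M) (vv : v^T *m v = 1%:M).
Hypotheses (uv : u^T *m v = 0) (c_neq0 : c != 0).
Hypotheses (Mu : M *m u = p *: u + c *: v) (Mv : M *m v = c *: u + q *: v).

Let vu : v^T *m u = 0.
Proof. by rewrite -[RHS]trmx0 -uv trmx_mul trmxK. Qed.

(** The equation on x says that (1, x) is an eigenvector of the 2 x 2 matrix
    with rows (p, c) and (c, q). *)
Lemma plane_eigenvec x : c * x ^+ 2 + (p - q) * x - c = 0 ->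
  M *m (u + x *: v) = (p + c * x) *: (u + x *: v).
Proof.
move=> x_root; rewrite mulmxDr -scalemxAr Mu Mv !scalerDr !scalerA addrACA.
rewrite -!scalerDl [x * c]mulrC; congr (_ + _ *: _).
apply/eqP; rewrite -subr_eq0 -oppr_eq0 -[X in _ == X]x_root; apply/eqP; ring.
Qed.

(** If w = u + x v is an eigenvector of M, then w is also a left eigenvector of
    the symmetric matrix exp(itM); evaluating w^T exp(itM) u in two ways gives
    e^(itl) = g x, so that x has modulus 1. *)
Lemma transfer_diag_eq : perfect_state_transfer M u v -> p = q.
Proof.
case=> _ _ _ [t [g [_ g1 Uu]]].
(* The discriminant is positive, so the eigenvector can be chosen real. *)
pose d := Num.sqrt ((q - p) ^+ 2 + 4 * c ^+ 2).
have dE : d ^+ 2 = (q - p) ^+ 2 + 4 * c ^+ 2.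
  by rewrite sqr_sqrtr // addr_ge0 ?sqr_ge0 // mulr_ge0 ?sqr_ge0.
pose x := (q - p + d) / (2 * c).
have x_root : c * x ^+ 2 + (p - q) * x - c = 0.
  transitivity ((d ^+ 2 - (q - p) ^+ 2 - 4 * c ^+ 2) / (4 * c)).
    by rewrite /x; field.
  by rewrite dE; field.
have := transition_mx_eigenvec t (plane_eigenvec x_root).
set w := u + _; set e := cis _ => Uw.
have wu : w^T *m u = 1%:M.
  by rewrite [w^T]linearD /= linearZ /= mulmxDl uu -scalemxAl vu scaler0 addr0.
have wv : w^T *m v = x%:M.
  rewrite [w^T]linearD /= linearZ /= mulmxDl uv -scalemxAl vv add0r.
  by rewrite scale_scalar_mx mulr1.
have gx : e = g * x%:C.
  have wU : (complexify w)^T *m transition_mx M t = e *: (complexify w)^T.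
    by rewrite -[in LHS](transition_mx_sym t M_sym) -trmx_mul Uw linearZ.
  have := congr1 (mulmx (complexify w)^T) Uu.
  rewrite mulmxA wU -scalemxAl -scalemxAr /complexify map_trmx -!map_mxM wu wv.
  rewrite !map_scalar_mx !scale_scalar_mx rmorph1 mulr1 => /matrixP/(_ 0 0).
  by rewrite [LHS]mxE [RHS]mxE.
have x_norm : `|x| = 1.
  apply: (@complexI R); rewrite -normc_real -[LHS]mul1r -g1 -normrM -gx.
  exact: norm_cis.
have x2 : x ^+ 2 = 1 by rewrite -real_normK ?num_real // x_norm expr1n.
have x_neq0 : x != 0 by rewrite -normr_gt0 x_norm.
apply/eqP; rewrite -subr_eq0 -(mulIr_eq0 _ (mulIf x_neq0)); apply/eqP.
by rewrite -x_root x2; ring.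
Qed.

(** The phases of u + v and u - v at time t are e^(itp) e^(itc) and
    e^(itp) e^(-itc); they are opposite as soon as cos (tc) = 0. *)
Lemma diag_eq_transfer :
  free [:: u; v] -> p = q -> perfect_state_transfer M u v.
Proof.
move=> uv_free pq; split=> //.
pose t := pi / (2 * `|c|).
have t_gt0 : 0 < t by rewrite divr_gt0 ?pi_gt0 // mulr_gt0 ?normr_gt0.
have cos_tc : cos (t * c) = 0.
  rewrite -cos_norm normrM (gtr0_norm t_gt0) -[RHS]cos_pihalf; congr cos.
  by rewrite /t; field; rewrite normr_eq0.
have cisN : cis (- (t * c)) = - cis (t * c).
  by rewrite /cis cosN sinN cos_tc rmorphN mulrN -mulN1r; ring.
exists t, (cis (t * p) * cis (t * c)); split=> //.
  by rewrite normrM !norm_cis mulr1.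
have x_root x : x ^+ 2 = 1 -> c * x ^+ 2 + (p - q) * x - c = 0.
  by move=> ->; rewrite pq; ring.
have Up := transition_mx_eigenvec t (plane_eigenvec (x_root 1 (expr1n _ _))).
have Um := transition_mx_eigenvec t
  (plane_eigenvec (x_root (-1) (etrans (sqrrN 1) (expr1n _ _)))).
rewrite scale1r mulr1 mulrDr cisD in Up.
rewrite scaleN1r mulrN1 mulrBr cisD cisN mulrN scaleNr in Um.
have uE : 2 *: u = (u + v) + (u - v).
  by rewrite addrACA subrr addr0 scaler_nat mulr2n.
have vE : 2 *: v = (u + v) - (u - v).
  by rewrite opprB addrC subrKA addrC scaler_nat mulr2n.
have two_neq0 : (2%:C : R[i]) != 0 by rewrite rmorph_nat pnatr_eq0.
apply: (scalerI two_neq0).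
rewrite scalerA [2%:C * _]mulrC -scalerA scalemxAr -!map_mxZ uE vE.
by rewrite map_mxD [in RHS]map_mxB mulmxDr Up Um scalerBr.
Qed.

End InvariantPlane.

Lemma perfect_state_transfer_plane (R : realType) (N : nat) (M : 'M[R]_N)
    (u v : 'cV[R]_N) (p q c : R) :
    M^T = M -> u^T *m u = 1%:M -> v^T *m v = 1%:M -> u^T *m v = 0 ->
    free [:: u; v] -> c != 0 ->
    M *m u = p *: u + c *: v -> M *m v = c *: u + q *: v ->
  perfect_state_transfer M u v <-> p = q.
Proof.
move=> Msym uu vv uv uv_free c0 Mu Mv; split.
  exact: transfer_diag_eq c0 Mu Mv.
exact: diag_eq_transfer c0 Mu Mv uv_free.
Qed.

(** * Pair states and the matrices of a graph *)

Section PairStates.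
Variables (R : realType) (T : finType) (G : sgraph T).
Implicit Types x y : T.

Lemma degreeE x : degree G x = (\sum_y G x y)%N.
Proof.
rewrite /degree -sum1_card big_mkcond; apply: eq_bigr => y _.
have -> : (y \in [set y | G x y]%classic) = G x y by apply/idP/idP; rewrite inE.
by case: (G x y).
Qed.

Lemma pair_stateE x y i j : pair_state R x y i j =
  (Num.sqrt 2)^-1 * ((enum_val i == x)%:R - (enum_val i == y)%:R).
Proof.
have char_vecE z : char_vec R z i j = (enum_val i == z)%:R.
  by rewrite mxE (ord1 j) eqxx andbT -(inj_eq enum_val_inj) enum_rankK.
by rewrite mxE [X in _ * X]mxE [X in _ + X]mxE !char_vecE.
Qed.

Lemma adjacency_pair_stateE x y i j :
  (adjacency_mx R G *m pair_state R x y) i j =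
  (Num.sqrt 2)^-1 * ((G (enum_val i) x)%:R - (G (enum_val i) y)%:R).
Proof.
rewrite -scalemxAr mulmxBr mxE [X in _ * X]mxE [X in _ + X]mxE.
have col z : (adjacency_mx R G *m char_vec R z) i j = (G (enum_val i) z)%:R.
  rewrite mxE (bigD1 (enum_rank z)) //= mxE [X in _ * X]mxE (ord1 j) !eqxx.
  rewrite mulr1 enum_rankK.
  by rewrite big1 ?addr0 // => k /negbTE kz; rewrite [X in _ * X]mxE kz mulr0.
by rewrite !col.
Qed.

Lemma degree_pair_state x y d : degree G x = d -> degree G y = d ->
  degree_mx R G *m pair_state R x y = d%:R *: pair_state R x y.
Proof.
move=> dx dy; apply/matrixP=> i j.
rewrite mul_diag_mx mxE [RHS]mxE [X in X * _]mxE pair_stateE.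
have [ix|_] := eqVneq (enum_val i) x; first by rewrite ix dx.
have [iy|_] := eqVneq (enum_val i) y; first by rewrite iy dy.
by rewrite subrr !mulr0.
Qed.

Lemma adjacency_mx_sym : (adjacency_mx R G)^T = adjacency_mx R G.
Proof. by apply/matrixP=> i j; rewrite !mxE adj_sym. Qed.

Lemma laplacian_mx_sym : (laplacian_mx R G)^T = laplacian_mx R G.
Proof. by rewrite linearB /= tr_diag_mx adjacency_mx_sym. Qed.

Lemma signless_laplacian_mx_sym :
  (signless_laplacian_mx R G)^T = signless_laplacian_mx R G.
Proof. by rewrite linearD /= tr_diag_mx adjacency_mx_sym. Qed.

End PairStates.

(** * The complementary prism of a complete bipartite graph *)

Section BipartitePrism.
Variables (R : realType) (m n : nat).

Let G := complementary_prism (complete_bipartite m n).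
Implicit Types x a b : 'I_m.

Let sum_inl_eq x : (\sum_(i < m) (inl x == inl i :> 'I_m + 'I_n) = 1)%N.
Proof.
rewrite (bigD1 x) //= eqxx big1 // => i /negbTE ix.
by rewrite -[inl x == inl i]/(x == i) eq_sym ix.
Qed.

Lemma Kmn_prism_degree_part x : degree G (inl (inl x)) = n.+1.
Proof.
rewrite degreeE !big_sumType /= big1 // [X in (_ + (_ + X))%N]big1 //.
by rewrite sum_inl_eq sum_nat_const card_ord muln1 addn0 addn1.
Qed.

Lemma Kmn_prism_degree_copy x : degree G (inr (inl x)) = m.
Proof.
rewrite degreeE !big_sumType /= [X in (_ + X + _)%N]big1 //.
rewrite [X in (_ + (_ + X))%N]big1 // !addn0 -big_split /=.
rewrite (eq_bigr (fun=> 1%N)) ?sum_nat_const ?card_ord ?muln1 // => i _.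
by rewrite /compl_adj andbT -[inl x == inl i]/(x == i); case: eqP.
Qed.

(** The n vertices of the other part see both a and b, so only the copies a' and
    b' survive in the difference. *)
Lemma Kmn_prism_adjacency_part a b :
  adjacency_mx R G *m pair_state R (inl (inl a)) (inl (inl b)) =
  pair_state R (inr (inl a)) (inr (inl b)).
Proof.
apply/matrixP=> i j; rewrite adjacency_pair_stateE pair_stateE.
by case: (enum_val i) => [[]|[]] x //=; rewrite !subrr.
Qed.

(** In the complement the part becomes a clique: every other copy sees both a'
    and b', while a' sees only b' and b' only a', which gives the term -v. *)
Lemma Kmn_prism_adjacency_copy a b :
  adjacency_mx R G *m pair_state R (inr (inl a)) (inr (inl b)) =
  pair_state R (inl (inl a)) (inl (inl b)) -
  pair_state R (inr (inl a)) (inr (inl b)).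
Proof.
apply/matrixP=> i j; rewrite adjacency_pair_stateE [RHS]mxE [X in _ = _ + X]mxE.
rewrite !pair_stateE -mulrBr; congr (_ * _).
case: (enum_val i) => [[]|[]] x /=; rewrite ?subrr ?subr0 //.
rewrite /compl_adj /= !andbT sub0r opprB.
rewrite -[inl x == inl a]/(x == a) -[inl x == inl b]/(x == b).
rewrite -[inr (inl x) == inr (inl a)]/(x == a).
rewrite -[inr (inl x) == inr (inl b)]/(x == b).
by case: (x == a); case: (x == b); rewrite /= ?subrr ?subr0 ?sub0r.
Qed.

End BipartitePrism.

Theorem theorem13 (R : realType) (m n : nat) (a b : 'I_m) (hab : a != b) :
  let G := complementary_prism (complete_bipartite m n) in
  let u := pair_state R (inl (inl a)) (inl (inl b)) in
  let v := pair_state R (inr (inl a)) (inr (inl b)) in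
  [/\ perfect_state_transfer (laplacian_mx R G) u v <-> m = n,
      perfect_state_transfer (signless_laplacian_mx R G) u v <->
        (m%:Z - n%:Z = 2 :> int)
    & ~ perfect_state_transfer (adjacency_mx R G) u v].
Proof.
move=> G u v.
have uu : u^T *m u = 1%:M by apply: pair_state_unit.
have vv : v^T *m v = 1%:M by apply: pair_state_unit.
have uv : u^T *m v = 0 by rewrite pair_state_dot /= !subr0 addr0 mulr0 raddf0.
have uv_free : free [:: u; v] by apply: pair_state_free.
have Au : adjacency_mx R G *m u = v := Kmn_prism_adjacency_part R n a b.
have Av : adjacency_mx R G *m v = u - v := Kmn_prism_adjacency_copy R n a b.
have Du : degree_mx R G *m u = n.+1%:R *: u.
  by apply: degree_pair_state; apply: Kmn_prism_degree_part.
have Dv : degree_mx R G *m v = m%:R *: v.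
  by apply: degree_pair_state; apply: Kmn_prism_degree_copy.
have one_neq0 : (1 : R) != 0 := oner_neq0 _.
have N1_neq0 : (-1 : R) != 0 by rewrite oppr_eq0.
have pst M p q c (Msym : M^T = M) :=
  perfect_state_transfer_plane (p := p) (q := q) (c := c) Msym uu vv uv uv_free.
split.
- have -> : (m = n) <-> (n.+1%:R = m.+1%:R :> R).
    by split=> [->|/eqP]; rewrite // eqr_nat eqSS => /eqP.
  apply: (pst _ _ _ _ (laplacian_mx_sym R G) N1_neq0).
    by rewrite mulmxBl Du Au scaleN1r.
  by rewrite mulmxBl Dv Av scaleN1r -natr1 scalerDl scale1r opprB addrA addrC.
- have -> : (m%:Z - n%:Z = 2 :> int) <-> (n.+1%:R = m%:R - 1 :> R).
    rewrite -natr1; split=> [mn|/eqP].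
      have -> : m = n.+2 by lia.
      by rewrite -!natr1; ring.
    by rewrite -subr_eq opprK natr1 natr1 eqr_nat => /eqP; lia.
  apply: (pst _ _ _ _ (signless_laplacian_mx_sym R G) one_neq0).
    by rewrite mulmxDl Du Au scale1r.
  by rewrite mulmxDl Dv Av scalerBl !scale1r addrCA.
- have := pst _ 0 (-1) 1 (adjacency_mx_sym R G) one_neq0.
  rewrite Au Av scale0r add0r !scale1r scaleN1r => /(_ erefl erefl) [no_pst _].
  by move=> /no_pst /esym/eqP; rewrite (negbTE N1_neq0).
Qed.
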